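(* If $D$ is a finite simple digraph with $\gamma_I(D)=3$ and $\gamma(D)=2$, then $r(D)\leq r_I(D)+1$.
   Context: A finite simple digraph has no loops and no multiple arcs (oppositely oriented arcs allowed). A set $S\subseteq V(D)$ is a dominating set if every vertex of $D$ is in $S$ or is an out-neighbor of some vertex of $S$; the domination number $\gamma(D)$ is the minimum size of a dominating set. For a set $R$ of arcs not in $A(D)$ (between distinct vertices), $D+R$ is $D$ with these arcs added. The reinforcement number $r(D)$ is the minimum number of extra arcs whose addition to $D$ yields a digraph $D'$ with $\gamma(D')<\gamma(D)$. An Italian dominating function (IDF) on $D$ is a function $f:V(D)\to\{0,1,2\}$ such that every vertex $v$ with $f(v)=0$ has at least two in-neighbors $w$ with $f(w)=1$ or at least one in-neighbor $w$ with $f(w)=2$; its weight is $\sum_u f(u)$ and $\gamma_I(D)$ is the minimum weight of an IDF. The Italian reinforcement number $r_I(D)$ is the minimum number of extra arcs whose addition to $D$ yields a digraph $D'$ with $\gamma_I(D')<\gamma_I(D)$ (defined to be $0$ if $\gamma_I(D)\leq 2$). *)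

(* Defs.v *)
From mathcomp Require Import all_boot.
Set Implicit Arguments.
Unset Strict Implicit.
Unset Printing Implicit Defensive.

(* A finite simple digraph on T is an irreflexive e : rel T; e u v is the arc
   from u to v, so e v u may hold as well. *)

Definition dominating (T : finType) (e : rel T) (S : {set T}) : bool :=
  [forall v, (v \in S) || [exists u in S, e u v]].

Definition gamma (T : finType) (e : rel T) : nat :=
  #|[arg min_(S < setT | dominating e S) #|S|]|.

Definition is_IDF (T : finType) (e : rel T) (f : {ffun T -> 'I_3}) : bool :=
  [forall v, (f v == 0 :> nat) ==>
    ((2 <= #|[set w | e w v & f w == 1 :> nat]|)
     || [exists w, e w v && (f w == 2 :> nat)])].

Definition weight (T : finType) (f : {ffun T -> 'I_3}) : nat := \sum_u f u.

Definition gammaI (T : finType) (e : rel T) : nat :=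
  weight [arg min_(f < [ffun=> inord 1] | is_IDF e f) weight f].

Definition missing_arcs (T : finType) (e : rel T) : {set T * T} :=
  [set a | (a.1 != a.2) && ~~ e a.1 a.2].

Definition add_arcs (T : finType) (e : rel T) (R : {set T * T}) : rel T :=
  [rel u v | e u v || ((u, v) \in R)].

Definition reinforces (T : finType) (g : rel T -> nat) (e : rel T)
    (R : {set T * T}) : bool :=
  (R \subset missing_arcs e) && (g (add_arcs e R) < g e).

(* No addition of arcs can lower gamma when gamma e <= 1; the value is then 0
   by convention. Otherwise adding all missing arcs lowers it
   (reinforces_gamma below), so the minimum ranges over a nonempty family. *)
Definition reinf (T : finType) (e : rel T) : nat :=
  if gamma e <= 1 then 0
  else #|[arg min_(R < missing_arcs e | reinforces (@gamma T) e R) #|R|]|.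

Definition reinfI (T : finType) (e : rel T) : nat :=
  if gammaI e <= 2 then 0
  else #|[arg min_(R < missing_arcs e | reinforces (@gammaI T) e R) #|R|]|.

(* [arg min_(x < x0 | P x) F x] is a minimum only if P x0 holds: the following
   lemmas check this for the four definitions above. *)

Lemma dominating_setT (T : finType) (e : rel T) : dominating e setT.
Proof. by apply/forallP=> v; rewrite in_setT. Qed.

Lemma is_IDF_const1 (T : finType) (e : rel T) : is_IDF e [ffun=> inord 1].
Proof. by apply/forallP=> v; rewrite ffunE inordK. Qed.

Lemma gamma_le (T : finType) (e : rel T) (S : {set T}) :
  dominating e S -> gamma e <= #|S|.
Proof.
rewrite /gamma; case: arg_minnP => [|S0 _ min_S0]; first exact: dominating_setT.
exact: min_S0.
Qed.

Lemma gammaI_le (T : finType) (e : rel T) (f : {ffun T -> 'I_3}) :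
  is_IDF e f -> gammaI e <= weight f.
Proof.
rewrite /gammaI; case: arg_minnP => [|f0 _ min_f0]; first exact: is_IDF_const1.
exact: min_f0.
Qed.

Lemma add_missing_arcs (T : finType) (e : rel T) (u v : T) :
  u != v -> add_arcs e (missing_arcs e) u v.
Proof. by move=> neq_uv; rewrite /add_arcs /= inE neq_uv orbN. Qed.

Lemma reinforces_gamma (T : finType) (e : rel T) :
  1 < gamma e -> reinforces (@gamma T) e (missing_arcs e).
Proof.
move=> gt1; rewrite /reinforces subxx /=; apply: leq_ltn_trans gt1.
case: (pickP T) => [x _ | T0].
  rewrite -(cards1 x); apply: gamma_le; apply/forallP=> v; rewrite inE.
  case: eqVneq => //= neq_vx; apply/existsP; exists x.
  by rewrite inE eqxx add_missing_arcs // eq_sym.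
apply: leq_trans (gamma_le (dominating_setT _)) _.
by rewrite cardsT eq_card0.
Qed.

Lemma reinforces_gammaI (T : finType) (e : rel T) :
  2 < gammaI e -> reinforces (@gammaI T) e (missing_arcs e).
Proof.
move=> gt2; rewrite /reinforces subxx /=; apply: leq_ltn_trans gt2.
case: (pickP T) => [x _ | T0]; last first.
  apply: leq_trans (gammaI_le (is_IDF_const1 _)) _.
  by rewrite /weight big_pred0.
pose f : {ffun T -> 'I_3} := [ffun v => if v == x then inord 2 else inord 0].
have wf : weight f = 2.
  rewrite /weight (bigD1 x) //= big1 ?ffunE ?eqxx ?inordK //.
  by move=> v /negbTE neq_vx; rewrite ffunE neq_vx inordK.
rewrite -wf; apply: gammaI_le; apply/forallP=> v; apply/implyP.
rewrite ffunE; case: (eqVneq v x) => [_ | neq_vx _]; first by rewrite inordK.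
apply/orP; right; apply/existsP; exists x.
  by rewrite ffunE eqxx inordK // eqxx andbT add_missing_arcs // eq_sym.
Qed.

(* Main.v *)
Require Import Defs.
From mathcomp Require Import all_boot.

(** An Italian dominating function of weight 2 puts either 2 on one vertex,
    which then dominates, or 1 on two vertices [x] and [y], and then both are
    in-neighbours of every other vertex. So after an optimal Italian
    reinforcement, [x] dominates as soon as the arc [(x, y)] is present. *)

Lemma sum_ge2 (T : finType) (F : T -> nat) (x y : T) :
  x != y -> F x + F y <= \sum_u F u.
Proof.
move=> neq_xy; rewrite (bigD1 x) //= leq_add2l (bigD1 y) 1?eq_sym //=.
exact: leq_addr.
Qed.

(** The witnesses may coincide: [x = y] covers a vertex of value 2 and the one-vertex digraph. The
    vertex [x0] excludes the empty digraph, which offers no witness. *)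
Lemma IDF_weight2 (T : finType) (e : rel T) (f : {ffun T -> 'I_3}) (x0 : T) :
  is_IDF e f -> weight f <= 2 ->
  exists x y, forall v, v != x -> v != y -> e x v.
Proof.
move=> /forallP IDFf wf2.
case: (pickP (fun x => f x == 2 :> nat)) => [x /eqP fx2 | no2].
  (* The value 2 at [x] uses up the whole weight. *)
  have f0 w : w != x -> f w = 0 :> nat.
    rewrite eq_sym => /(sum_ge2 T (fun u => f u)) /leq_trans/(_ wf2).
    by rewrite fx2; case: (nat_of_ord (f w)).
  exists x, x => v neq_vx _.
  have /implyP/(_ (introT eqP (f0 v neq_vx)))/orP[two1 | ] := IDFf v.
    have: 0 < #|[set w | e w v & f w == 1 :> nat]| by apply: ltnW.
    case/card_gt0P=> w; rewrite inE => /andP[_ /eqP fw1].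
    have [eq_wx | /f0] := eqVneq w x; last by rewrite fw1.
    by move: fw1; rewrite eq_wx fx2.
  case/existsP=> w /andP[ewv /eqP fw2].
  by have [<- // | /f0] := eqVneq w x; rewrite fw2.
pose S := [set w | f w == 1 :> nat].
pose N v := [set w | e w v & f w == 1 :> nat].
have S2 : #|S| <= 2.
  apply: leq_trans wf2; rewrite -sum1_card /weight big_mkcond /=.
  by apply: leq_sum => u _; rewrite inE; case: eqP => // ->.
have sub_NS v : N v \subset S by apply/subsetP=> u; rewrite !inE => /andP[].
have two1 v : v \notin S -> 2 <= #|N v|.
  rewrite inE => fv1; have /implyP fv := IDFf v.
  have /fv/orP[//|/existsP[w]] : f v == 0 :> nat.
    move: fv1 (no2 v) (ltn_ord (f v)).
    by case: (nat_of_ord (f v)) => [|[|[|]]].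
  by rewrite no2 andbF.
(* A vertex outside [S] has at least two in-neighbours in [S], and [S] has at most two elements, so
   [N v] is all of [S]. *)
have S_e v w : v \notin S -> w \in S -> e w v.
  move=> /two1 two1v.
  have /eqP <- : N v == S by rewrite eqEcard sub_NS (leq_trans S2).
  by rewrite inE => /andP[].
have [x Sx] : exists x, x \in S.
  apply/card_gt0P; have [x0S | /two1 N2] := boolP (x0 \in S).
    by apply/card_gt0P; exists x0.
  exact: leq_trans (ltnW N2) (subset_leq_card (sub_NS x0)).
have [y Sy | S1] := pickP [in S :\ x].
  exists x, y => v neq_vx neq_vy; apply: S_e => //; apply/negP=> Sv.
  have: #|S :\ x| <= 1 by move: S2; rewrite (cardsD1 x) Sx.
  have Sxv : v \in S :\ x by rewrite in_setD1 neq_vx.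
  by move/card_le1_eqP/(_ y v Sy Sxv)/eqP; rewrite (negbTE neq_vy).
exists x, x => v neq_vx _; apply: S_e => //.
by have := S1 v; rewrite /= in_setD1 neq_vx /= => ->.
Qed.

Theorem theorem4p5 (T : finType) (e : rel T) (e_irr : irreflexive e)
    (hI : gammaI e = 3) (hg : gamma e = 2) :
  reinf e <= reinfI e + 1.
Proof.
rewrite /reinf /reinfI hg hI /=.
case: arg_minnP => [|R0 _ minR0]; first by apply: reinforces_gamma; rewrite hg.
case: arg_minnP => [|R /andP[sRm]]; first by apply: reinforces_gammaI; rewrite hI.
rewrite hI ltnS {1}/gammaI.
case: arg_minnP => [|f IDFf _ wf2 _]; first exact: is_IDF_const1.
(* On an empty type [gamma e] would be 0, not 2. *)
have x0 : T.
  case: (pickP T) => [x _ // | T0].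
  by have := gamma_le (dominating_setT e); rewrite hg cardsT eq_card0.
have [x [y dom_x]] := IDF_weight2 T _ f x0 IDFf wf2.
(* The pair [(x, y)] may be a loop or already an arc of [e]; the intersection discards it in that
   case, so [R'] is an admissible set of new arcs. *)
pose R' := ((x, y) |: R) :&: missing_arcs e.
apply: leq_trans (minR0 R' _) _; last first.
  apply: leq_trans (subset_leq_card (subsetIl _ _)) _.
  by rewrite cardsU1 addnC leq_add2l leq_b1.
rewrite /reinforces subsetIr hg ltnS -(cards1 x); apply: gamma_le.
apply/forallP=> v; rewrite inE; case: eqVneq => //= neq_vx.
apply/existsP; exists x; rewrite inE eqxx /add_arcs /= !inE /= (eq_sym x) neq_vx.
(* If [e x v] fails, [(x, v)] is a missing arc and survives the intersection: it is the added pair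
   when [v = y], and otherwise it lies in [R]. *)
case exv: (e x v) => //=; rewrite andbT xpair_eqE eqxx /=.
have [// | neq_vy] := eqVneq v y.
by have /orP[|] := dom_x v neq_vx neq_vy; rewrite ?exv.
Qed.
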